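(* Suppose that $W$ satisfies the network assumption and that each $f_i(y)=\frac12 (y-b_i)^T B_{ii}(y-b_i)$, $i=1,\dots,N$, is $\mu$-strongly convex with $\mu>0$. Let $\{\theta_s\}$ be a sequence of positive penalty parameters with $\theta_s\to\infty$, and let $\{\varepsilon_s\}$ be a positive sequence with $\varepsilon_s\to 0$. For every $s$ let $$k(s)=\left\lceil \left|\frac{\log(\mu\varepsilon_{s+1})-\log\big((L+2\theta_{s+1})(\varepsilon_s+2\bar c)\big)}{\log(\rho_{s+1})}\right|\right\rceil ,$$ where $\rho_{s+1}$ is a constant such that $\|\mathbb{M}(\theta_{s+1})\|\le\rho_{s+1}<1$ and $\bar c=\|\mathbf{c}\|$. Let $\{\mathbf{x}^s\}$ be a sequence generated by Algorithm EFIX-Q. Then either the sequence $\{\mathbf{x}^s\}$ is unbounded, or it converges to a solution $\mathbf{x}^*=(x_1^*;\dots;x_N^* )$ of the problem $$\min_{\mathbf{x}\in\mathbb{R}^{nN}} F(\mathbf{x})=\sum_{i=1}^N f_i(x_i)\quad\text{s.t.}\quad (\mathbb{I}-\mathbb{W})^{1/2}\mathbf{x}=0,$$ and $x_i^*$ is the solution of the problem $\min_{y\in\mathbb{R}^n} f(y)=\sum_{j=1}^N f_j(y)$ for every $i=1,\dots,N$.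
   Context: Network assumption: $W=[w_{ij}]\in\mathbb{R}^{N\times N}$ is symmetric and doubly stochastic, with $w_{ij}>0$ if $j\in\bar O_i$ and $w_{ij}=0$ if $j\notin \bar O_i$, where $\bar O_i=O_i\cup\{i\}$ and $O_i$ is the set of neighbours of node $i$ in an undirected connected graph on the $N$ nodes. Problem data: $B_{ii}=B_{ii}^T\in\mathbb{R}^{n\times n}$, $b_i\in\mathbb{R}^n$; $\mathbb{B}=\mathrm{diag}(B_{11},\dots,B_{NN})\in\mathbb{R}^{nN\times nN}$ is block diagonal, $\mathbf{b}=(b_1;\dots;b_N)\in\mathbb{R}^{nN}$. $\mathbb{I}$ is the identity on $\mathbb{R}^{nN}$, $\mathbb{W}=W\otimes I$ with $I$ the $n\times n$ identity, $\mathbb{L}=\mathbb{I}-\mathbb{W}$. For $\theta>0$ the quadratic penalty function is $\Phi_\theta(\mathbf{x})=F(\mathbf{x})+\frac{\theta}{2}\mathbf{x}^T\mathbb{L}\mathbf{x}$, whose gradient is $\nabla\Phi_\theta(\mathbf{x})=\mathbb{A}(\theta)\mathbf{x}-\mathbf{c}$ with $\mathbb{A}(\theta)=\mathbb{B}+\theta\mathbb{L}$, $\mathbf{c}=\mathbb{B}\mathbf{b}$. $L=\max_i l_i$, where $l_i$ is the largest eigenvalue of $B_{ii}$; $\bar w=\max_i w_{ii}<1$. $\|\cdot\|$ is the Euclidean norm (and the induced matrix norm). JOR (Jacobi Over-Relaxation) iteration for $\mathbb{A}(\theta)\mathbf{x}=\mathbf{c}$: let $\mathbb{D}$ be the diagonal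 matrix with the same diagonal as $\mathbb{A}(\theta)$, $\mathbb{G}=\mathbb{D}-\mathbb{A}(\theta)$, and let $q$ be a relaxation parameter with $0<q<\frac{2\theta(1-\bar w)}{L+2\theta}$ (chosen for the given $\theta$). Put $\mathbb{M}(\theta)=q\mathbb{D}^{-1}\mathbb{G}+(1-q)\mathbb{I}$, $\mathbf{p}(\theta)=q\mathbb{D}^{-1}\mathbf{c}$; the iteration is $\mathbf{z}^{k+1}=\mathbb{M}(\theta)\mathbf{z}^k+\mathbf{p}(\theta)$. Algorithm EFIX-Q: given $\{\theta_s\}$, an initial point $\mathbf{x}^0\in\mathbb{R}^{nN}$ and inner iteration counts $\{k(s)\}$, for $s=0,1,2,\dots$ the outer step from $\mathbf{x}^s$ sets $\mathbf{z}^0=\mathbf{x}^s$, performs $\mathbf{z}^{k+1}=\mathbb{M}(\theta_{s+1})\mathbf{z}^k+\mathbf{p}(\theta_{s+1})$ for $k=0,\dots,k(s)-1$, and sets $\mathbf{x}^{s+1}=\mathbf{z}^{k(s)}$. *)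

(* Defs.v *)
From HB Require Import structures.
From mathcomp Require Import all_boot all_order all_algebra.
From mathcomp Require Import all_classical all_reals all_analysis.

Set Implicit Arguments.
Unset Strict Implicit.
Unset Printing Implicit Defensive.

Import Order.TTheory GRing.Theory Num.Theory.
Import numFieldNormedType.Exports.

Local Open Scope classical_set_scope.
Local Open Scope ring_scope.

Section EuclideanNorms.
Variable R : realType.

(* The library's norm on matrices is the sup norm, hence the definitions below. *)
Definition enorm (m : nat) (x : 'cV[R]_m) : R := Num.sqrt (\sum_i x i 0 ^+ 2).

Definition opnorm (m : nat) (A : 'M[R]_m) : R :=
  sup [set enorm (A *m x) | x in [set x : 'cV[R]_m | enorm x <= 1]].

Definition bounded_seq (m : nat) (x : nat -> 'cV[R]_m) : Prop :=
  exists C : R, forall s, enorm (x s) <= C.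

Definition converges_to (m : nat) (x : nat -> 'cV[R]_m) (l : 'cV[R]_m) : Prop :=
  enorm (x s - l) @[s --> \oo] --> (0 : R).

End EuclideanNorms.

Section Optimization.
Variable R : realType.

Definition strongly_convex (m : nat) (mu : R) (f : 'cV[R]_m -> R) : Prop :=
  forall (x y : 'cV[R]_m) (t : R), 0 <= t <= 1 ->
    f (t *: x + (1 - t) *: y) <=
    t * f x + (1 - t) * f y - mu / 2 * t * (1 - t) * enorm (x - y) ^+ 2.

Definition is_minimizer (T : Type) (D : set T) (f : T -> R) (x : T) : Prop :=
  D x /\ forall y, D y -> f x <= f y.

Definition is_unique_minimizer (T : Type) (D : set T) (f : T -> R) (x : T) :
    Prop :=
  is_minimizer D f x /\ forall y, is_minimizer D f y -> y = x.

End Optimization.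

Section Matrices.
Variable R : realType.

Definition psdmx (m : nat) (A : 'M[R]_m) : Prop :=
  A^T = A /\ forall x : 'cV[R]_m, 0 <= (x^T *m A *m x) 0 0.

(* The principal square root: a positive semidefinite [A] has exactly one
   positive semidefinite [S] with [S *m S = A]. The value is [0] if [A] has no
   such root. *)
Definition sqrtmx (m : nat) (A : 'M[R]_m) : 'M[R]_m :=
  xget 0 [set S : 'M[R]_m | psdmx S /\ S *m S = A].

(* [sup] is attained here: a matrix has finitely many eigenvalues, and a
   symmetric one of positive size has at least one in [R]. *)
Definition max_eigenvalue (m : nat) (A : 'M[R]_m) : R :=
  sup [set a : R | eigenvalue A a].

Definition diag_part (m : nat) (A : 'M[R]_m) : 'M[R]_m :=
  diag_mx (\row_i A i i).

End Matrices.

Section Network.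
Variables (R : realType) (N : nat).

Definition connected_simple_graph (e : rel 'I_N) : Prop :=
  [/\ symmetric e, irreflexive e & forall i j, connect e i j].

Definition neighbours (e : rel 'I_N) (i : 'I_N) : {set 'I_N} := [set j | e i j]%SET.

Definition closed_neighbours (e : rel 'I_N) (i : 'I_N) : {set 'I_N} :=
  (i |: neighbours e i)%SET.

Definition doubly_stochastic (W : 'M[R]_N) : Prop :=
  [/\ forall i j, 0 <= W i j,
      forall i, \sum_j W i j = 1
    & forall j, \sum_i W i j = 1].

Definition network_assumption (e : rel 'I_N) (W : 'M[R]_N) : Prop :=
  [/\ connected_simple_graph e,
      W^T = W,
      doubly_stochastic W,
      forall i j, j \in closed_neighbours e i -> 0 < W i j
    & forall i j, j \notin closed_neighbours e i -> W i j = 0].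

Definition max_weight (W : 'M[R]_N) : R := sup (range (fun i => W i i)).

End Network.

(* R^(nN) as N stacked blocks of size n: this is the index type for which the
   library's block matrices ([\mxcol], [\mxdiag], [\mxblock]) are set up. *)
Notation "''bV[' R ]_ ( N , n )" := 'cV[R]_(\sum_(i < N) n)
  (at level 8, R, N, n at level 35, format "''bV[' R ]_ ( N ,  n )") : type_scope.

Notation "''bM[' R ]_ ( N , n )" := 'M[R]_(\sum_(i < N) n)
  (at level 8, R, N, n at level 35, format "''bM[' R ]_ ( N ,  n )") : type_scope.

Section Problem.
Variables (R : realType) (N n : nat).
Implicit Types (W : 'M[R]_N) (B : 'I_N -> 'M[R]_n) (b : 'I_N -> 'cV[R]_n).

Definition block (x : 'bV[R]_(N, n)) (i : 'I_N) : 'cV[R]_n := submxcol x i.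

Definition local_cost B b (i : 'I_N) (y : 'cV[R]_n) : R :=
  2^-1 * ((y - b i)^T *m B i *m (y - b i)) 0 0.

Definition separable_cost B b (x : 'bV[R]_(N, n)) : R :=
  \sum_i local_cost B b i (block x i).

Definition aggregate_cost B b (y : 'cV[R]_n) : R := \sum_i local_cost B b i y.

(* the Kronecker product of [W] with the n x n identity *)
Definition kron_id W : 'bM[R]_(N, n) :=
  \mxblock_(i < N, j < N) (W i j *: (1%:M : 'M[R]_n)).

Definition laplacian W : 'bM[R]_(N, n) := 1%:M - kron_id W.

Definition consensus W : set 'bV[R]_(N, n) :=
  [set x | sqrtmx (laplacian W) *m x = 0].

Definition BB B : 'bM[R]_(N, n) := \mxdiag_(i < N) B i.

Definition stacked b : 'bV[R]_(N, n) := \mxcol_(i < N) b i.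

Definition rhs B b : 'bV[R]_(N, n) := BB B *m stacked b.

Definition lipschitz_const B : R := sup (range (fun i => max_eigenvalue (B i))).

Definition penalty_matrix W B (theta : R) : 'bM[R]_(N, n) :=
  BB B + theta *: laplacian W.

Definition jor_matrix W B (theta q : R) : 'bM[R]_(N, n) :=
  let A := penalty_matrix W B theta in
  let D := diag_part A in
  let G := D - A in
  q *: (invmx D *m G) + (1 - q) *: 1%:M.

Definition jor_shift W B b (theta q : R) : 'bV[R]_(N, n) :=
  q *: (invmx (diag_part (penalty_matrix W B theta)) *m rhs B b).

Definition jor_step W B b (theta q : R) (z : 'bV[R]_(N, n)) : 'bV[R]_(N, n) :=
  jor_matrix W B theta q *m z + jor_shift W B b theta q.

Definition inner_iterations B b (mu : R) (theta eps rho : nat -> R) (s : nat) :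
    nat :=
  let L := lipschitz_const B in
  let cbar := enorm (rhs B b) in
  `|Num.ceil
      `|(ln (mu * eps s.+1)
         - ln ((L + 2 * theta s.+1) * (eps s + 2 * cbar))) / ln (rho s.+1)| |%N.

Definition efix_q_sequence W B b (theta q : nat -> R) (k : nat -> nat)
    (x : nat -> 'bV[R]_(N, n)) : Prop :=
  forall s, x s.+1 = iter (k s) (jor_step W B b (theta s.+1) (q s.+1)) (x s).

End Problem.

(* Main.v *)
Require Import Defs.
From HB Require Import structures.
From mathcomp Require Import all_boot all_order all_algebra.
From mathcomp Require Import all_classical all_reals all_analysis.
From mathcomp Require Import ring lra.

Set Implicit Arguments.
Unset Strict Implicit.
Unset Printing Implicit Defensive.

Import Order.TTheory GRing.Theory Num.Theory.
Import numFieldNormedType.Exports.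

Local Open Scope classical_set_scope.
Local Open Scope ring_scope.

(* Let [z s] solve [A(theta_s) z = c]; coercivity gives [mu |z s| <= |c|]. The
   outer step contracts the distance to [z s.+1] by the factor [rho ^ k(s)], and
   the choice of [k(s)] makes this at most
   [mu eps_(s+1) / ((L + 2 theta_(s+1)) (eps_s + 2 |c|))]. As soon as
   [L + 2 theta_s >= mu], the bound [mu |x s - z s| <= K eps_s] propagates from
   [s] to [s.+1], so [x s - z s] tends to [0] for any initial point. The
   consensus solution [x*] satisfies [c - B x* = L v] for some [v], since the
   range of the Laplacian [L] is the orthogonal complement of the consensus
   space, and then [mu |z s - x*|^2 <= v^T L v / (4 theta_s)], which tends to
   [0]. The sequence is thus always convergent. *)

(** * Euclidean inner product, vector norm and operator norm *)

Section InnerProduct.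
Variables (R : realType) (m : nat).
Implicit Types (x y z : 'cV[R]_m) (A : 'M[R]_m) (a : R).

Definition dot x y : R := (x^T *m y) 0 0.

Lemma dotE x y : dot x y = \sum_i x i 0 * y i 0.
Proof. by rewrite /dot mxE; apply: eq_bigr => i _; rewrite !mxE. Qed.

Lemma dotC x y : dot x y = dot y x.
Proof. by rewrite !dotE; apply: eq_bigr => i _; rewrite mulrC. Qed.

Lemma dotDr x y z : dot x (y + z) = dot x y + dot x z.
Proof. by rewrite /dot mulmxDr mxE. Qed.

Lemma dotNr x y : dot x (- y) = - dot x y.
Proof. by rewrite /dot mulmxN mxE. Qed.

Lemma dotZr a x y : dot x (a *: y) = a * dot x y.
Proof. by rewrite /dot -scalemxAr mxE. Qed.

Lemma dotDl x y z : dot (y + z) x = dot y x + dot z x.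
Proof. by rewrite dotC dotDr !(dotC x). Qed.

Lemma dotNl x y : dot (- y) x = - dot y x.
Proof. by rewrite dotC dotNr (dotC x). Qed.

Lemma dotZl a x y : dot (a *: y) x = a * dot y x.
Proof. by rewrite dotC dotZr (dotC x). Qed.

Definition dot_lin := (dotDr, dotDl, dotNr, dotNl, dotZr, dotZl).

Lemma dot_mulmxr A x y : dot x (A *m y) = dot (A^T *m x) y.
Proof. by rewrite /dot trmx_mul trmxK mulmxA. Qed.

Lemma quad_dot A x : (x^T *m A *m x) 0 0 = dot x (A *m x).
Proof. by rewrite /dot mulmxA. Qed.

Lemma dot_sqr x : dot x x = \sum_i x i 0 ^+ 2.
Proof. by rewrite dotE; apply: eq_bigr => i _; rewrite expr2. Qed.

Lemma dot_ge0 x : 0 <= dot x x.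
Proof. by rewrite dot_sqr sumr_ge0// => i _; rewrite sqr_ge0. Qed.

Lemma sqr_enorm x : enorm x ^+ 2 = dot x x.
Proof. by rewrite /enorm -dot_sqr sqr_sqrtr ?dot_ge0. Qed.

Lemma enorm_ge0 x : 0 <= enorm x.
Proof. exact: sqrtr_ge0. Qed.

Lemma enorm_eq0P x : enorm x = 0 -> x = 0.
Proof.
move=> x0; have /eqP : dot x x = 0 by rewrite -sqr_enorm x0 expr0n.
rewrite dot_sqr psumr_eq0 => [/allP x0i|i _]; last exact: sqr_ge0.
apply/colP => i; rewrite mxE; apply/eqP.
by have := x0i i (mem_index_enum i); rewrite sqrf_eq0.
Qed.

Lemma enorm0 : enorm (0 : 'cV[R]_m) = 0.
Proof. by rewrite /enorm big1 ?sqrtr0// => i _; rewrite mxE expr0n. Qed.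

Lemma enormZ a x : enorm (a *: x) = `|a| * enorm x.
Proof.
rewrite /enorm -sqrtr_sqr -sqrtrM ?sqr_ge0//; congr Num.sqrt.
by rewrite mulr_sumr; apply: eq_bigr => i _; rewrite mxE exprMn.
Qed.

Lemma enormN x : enorm (- x) = enorm x.
Proof. by rewrite -scaleN1r enormZ normrN1 mul1r. Qed.

(** Cauchy-Schwarz: the squared norm of [|y| x - |x| y] equals [2 |x| |y| (|x| |y| - dot x y)];
    vectors of norm zero are treated first. *)
Lemma dot_le_enorm x y : dot x y <= enorm x * enorm y.
Proof.
have [x0|x0] := eqVneq (enorm x) 0.
  by rewrite (enorm_eq0P x0) dotE big1 ?enorm0 ?mul0r// => i _; rewrite mxE mul0r.
have [y0|y0] := eqVneq (enorm y) 0.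
  by rewrite (enorm_eq0P y0) dotE big1 ?enorm0 ?mulr0// => i _; rewrite mxE mulr0.
have xp : 0 < enorm x by rewrite lt_def x0 enorm_ge0.
have yp : 0 < enorm y by rewrite lt_def y0 enorm_ge0.
have := dot_ge0 (enorm y *: x - enorm x *: y).
rewrite !dot_lin -!sqr_enorm (dotC y x).
set a := enorm x in xp *; set b := enorm y in yp *; set d := dot x y => h.
have : 0 <= 2 * (a * b) * (a * b - d) by apply: le_trans h _; nra.
by rewrite pmulr_rge0 ?subr_ge0// !mulr_gt0.
Qed.

Lemma enormD x y : enorm (x + y) <= enorm x + enorm y.
Proof.
rewrite -(@ler_pXn2r _ 2) ?nnegrE ?addr_ge0 ?enorm_ge0//.
rewrite sqr_enorm !dot_lin -!sqr_enorm (dotC y x).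
have := dot_le_enorm x y; nra.
Qed.

Lemma enorm_sum (I : Type) (r : seq I) (f : I -> 'cV[R]_m) :
  enorm (\sum_(i <- r) f i) <= \sum_(i <- r) enorm (f i).
Proof.
elim/big_rec2: _ => [|i u v _ h]; first by rewrite enorm0.
by apply: le_trans (enormD _ _) _; rewrite lerD2l.
Qed.

Lemma coord_le_enorm x i : `|x i 0| <= enorm x.
Proof.
rewrite -(@ler_pXn2r _ 2) ?nnegrE ?enorm_ge0// sqr_enorm dot_sqr real_normK ?num_real//.
by rewrite (bigD1 i)//= lerDl sumr_ge0// => j _; rewrite sqr_ge0.
Qed.

(** [opnorm] is a [sup], which dominates its set only once that set is known to be bounded.
    Coordinates in the unit ball are at most 1 in absolute value, so the sum of the column norms is
    a bound. *)
Lemma opnorm_has_ubound A :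
  has_ubound [set enorm (A *m x) | x in [set x : 'cV[R]_m | enorm x <= 1]].
Proof.
exists (\sum_j enorm (col j A)) => _ [x /= x1 <-].
have -> : A *m x = \sum_j x j 0 *: col j A.
  by apply/colP => i; rewrite mxE summxE; apply: eq_bigr => j _; rewrite !mxE mulrC.
apply: le_trans (enorm_sum _ _) _; apply: ler_sum => j _.
rewrite enormZ ler_piMl ?enorm_ge0//.
exact: le_trans (coord_le_enorm _ _) x1.
Qed.

Lemma enorm_mulmx A x : enorm (A *m x) <= opnorm A * enorm x.
Proof.
have [x0|x0] := eqVneq (enorm x) 0.
  by rewrite (enorm_eq0P x0) mulmx0 !enorm0 mulr0.
have xp : 0 < enorm x by rewrite lt_def x0 enorm_ge0.
rewrite -ler_pdivrMr//.
have -> : enorm (A *m x) / enorm x = enorm (A *m ((enorm x)^-1 *: x)).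
  by rewrite -scalemxAr enormZ ger0_norm ?invr_ge0 ?enorm_ge0// mulrC.
apply: ub_le_sup; first exact: opnorm_has_ubound.
exists ((enorm x)^-1 *: x) => //=.
by rewrite enormZ ger0_norm ?invr_ge0 ?enorm_ge0// mulVf.
Qed.

Lemma opnorm_ge0 A : 0 <= opnorm A.
Proof.
apply: ub_le_sup; first exact: opnorm_has_ubound.
by exists 0 => /=; rewrite ?mulmx0 enorm0.
Qed.

(** Serves to derive [0 < rho] from a nonzero iteration matrix, so that [ln rho] is a genuine
    logarithm. *)
Lemma opnorm_eq0P A : opnorm A = 0 -> A = 0.
Proof.
move=> A0; apply/matrixP => i j.
have : A *m delta_mx j 0 = 0 :> 'cV_m.
  apply/enorm_eq0P/eqP; rewrite eq_le enorm_ge0 andbT.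
  by have := enorm_mulmx A (delta_mx j 0); rewrite A0 mul0r.
by rewrite -colE => /colP /(_ i); rewrite !mxE.
Qed.

End InnerProduct.

(** * Semidefiniteness of [1 - A] for symmetric nonnegative [A] with row sums at most 1 *)

(** Dirichlet form: by symmetry the indices can be exchanged, and the quadratic form splits into
    row-sum defects and squared differences. When the row sums are 1 only the differences remain,
    and they detect the kernel. *)
Lemma quad_sub1 (R : realType) (m : nat) (A : 'M[R]_m) (x : 'cV[R]_m) : A^T = A ->
  dot x ((1%:M - A) *m x) = \sum_i (1 - \sum_j A i j) * x i 0 ^+ 2 +
    2^-1 * \sum_i \sum_j A i j * (x i 0 - x j 0) ^+ 2.
Proof.
move=> A_sym.
have -> : \sum_i \sum_j A i j * (x i 0 - x j 0) ^+ 2 =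
    \sum_i \sum_j A i j * x i 0 ^+ 2 + \sum_i \sum_j A i j * x j 0 ^+ 2 -
    2 * \sum_i \sum_j A i j * (x i 0 * x j 0).
  rewrite mulr_sumr -big_split -sumrB; apply: eq_bigr => i _ /=.
  rewrite mulr_sumr -big_split -sumrB; apply: eq_bigr => j _ /=.
  by ring.
have -> : \sum_i \sum_j A i j * x j 0 ^+ 2 = \sum_i \sum_j A i j * x i 0 ^+ 2.
  rewrite exchange_big; apply: eq_bigr => i _; apply: eq_bigr => j _ /=.
  by rewrite -[in LHS]A_sym mxE.
rewrite mulmxBl mul1mx !dot_lin.
have -> : dot x (A *m x) = \sum_i \sum_j A i j * (x i 0 * x j 0).
  rewrite dotE; apply: eq_bigr => i _; rewrite mxE mulr_sumr.
  by apply: eq_bigr => j _; rewrite mulrCA.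
have -> : \sum_i (1 - \sum_j A i j) * x i 0 ^+ 2 =
    dot x x - \sum_i \sum_j A i j * x i 0 ^+ 2.
  rewrite dot_sqr -sumrB; apply: eq_bigr => i _.
  by rewrite mulrBl mul1r mulr_suml.
by field.
Qed.

(** Row sums below 1 are allowed because this is also applied to the limit of [sqrt_iter], where
    only the inequality is available. *)
Lemma psdmx_sub1 (R : realType) (m : nat) (A : 'M[R]_m) :
  A^T = A -> (forall i j, 0 <= A i j) ->
  (forall i, \sum_j A i j <= 1) -> psdmx (1%:M - A).
Proof.
move=> A_sym A_ge0 A_le1; split; first by rewrite linearB /= trmx1 A_sym.
move=> x; rewrite quad_dot quad_sub1//; apply: addr_ge0.
  by apply: sumr_ge0 => i _; rewrite mulr_ge0 ?sqr_ge0// subr_ge0.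
rewrite mulr_ge0 ?invr_ge0//; apply: sumr_ge0 => i _.
by apply: sumr_ge0 => j _; rewrite mulr_ge0 ?sqr_ge0.
Qed.

(** * Existence and kernel of the square root of [1 - M] *)

Section SquareRoot.
Variables (R : realType) (m : nat) (M : 'M[R]_m).
Hypotheses (M_sym : M^T = M) (M_ge0 : forall i j, 0 <= M i j)
  (M_le1 : forall i, \sum_j M i j <= 1).

(* If [Y] solves [2 Y = M + Y ^ 2] then [(1 - Y) ^ 2 = 1 - M]; the fixed-point
   iteration from [0] is monotone in each entry. *)
Fixpoint sqrt_iter (k : nat) : 'M[R]_m :=
  if k is k'.+1 then 2^-1 *: (M + sqrt_iter k' *m sqrt_iter k') else 0.

Lemma sqrt_iter_sym k : (sqrt_iter k)^T = sqrt_iter k.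
Proof.
elim: k => [|k IH] /=; first by rewrite trmx0.
by rewrite linearZ /= linearD /= trmx_mul IH M_sym.
Qed.

Lemma sqrt_iter_ge0 k i j : 0 <= sqrt_iter k i j.
Proof.
elim: k i j => [|k IH] i j /=; first by rewrite mxE.
rewrite !mxE mulr_ge0 ?invr_ge0// addr_ge0// sumr_ge0// => l _.
by rewrite mulr_ge0.
Qed.

(** Nonnegative matrices with row sums at most 1 are closed under products, and the recursion
    averages such a product with [M]. *)
Lemma sqrt_iter_le1 k i : \sum_j sqrt_iter k i j <= 1.
Proof.
elim: k i => [|k IH] i /=; first by rewrite big1// => j _; rewrite mxE.
have -> : \sum_j (2^-1 *: (M + sqrt_iter k *m sqrt_iter k)) i j =
    2^-1 * (\sum_j M i j + \sum_l sqrt_iter k i l * \sum_j sqrt_iter k l j).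
  under eq_bigr do rewrite !mxE.
  rewrite -mulr_sumr big_split /= exchange_big /=; congr (_ * (_ + _)).
  by apply: eq_bigr => l _; rewrite mulr_sumr.
have : \sum_l sqrt_iter k i l * \sum_j sqrt_iter k l j <= \sum_l sqrt_iter k i l.
  by apply: ler_sum => l _; rewrite ler_piMr ?sqrt_iter_ge0.
move: (M_le1 i) (IH i); lra.
Qed.

Lemma sqrt_iter_nondecreasing i j : nondecreasing_seq (fun k => sqrt_iter k i j).
Proof.
apply/nondecreasing_seqP => k; elim: k i j => [|k IH] i j.
  by rewrite [leLHS]mxE sqrt_iter_ge0.
rewrite [leLHS]mxE [leRHS]mxE ler_pM2l ?invr_gt0//.
rewrite [leLHS]mxE [leRHS]mxE lerD2l [leLHS]mxE [leRHS]mxE.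
by apply: ler_sum => l _; apply: ler_pM (IH _ _) (IH _ _); exact: sqrt_iter_ge0.
Qed.

Lemma sqrt_iter_cvg i j : cvgn (fun k => sqrt_iter k i j).
Proof.
apply: nondecreasing_is_cvgn; first exact: sqrt_iter_nondecreasing.
exists 1 => _ [k _ <-]; apply: le_trans (sqrt_iter_le1 k i).
by rewrite (bigD1 j)//= lerDl sumr_ge0// => l _; exact: sqrt_iter_ge0.
Qed.

Lemma psd_sqrt_ex : exists S : 'M[R]_m, psdmx S /\ S *m S = 1%:M - M.
Proof.
pose Y : 'M[R]_m := \matrix_(i, j) limn (fun k => sqrt_iter k i j).
have YE i j : sqrt_iter k i j @[k --> \oo] --> Y i j.
  by rewrite mxE; exact: sqrt_iter_cvg.
have Y_sym : Y^T = Y.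
  apply/matrixP => i j; rewrite !mxE; congr (limn _); apply/funext => k.
  by rewrite -[in LHS]sqrt_iter_sym mxE.
(* The shifted iterates converge entrywise to both sides, so the recursion passes to the limit. *)
have Y_fix : Y = 2^-1 *: (M + Y *m Y).
  apply/matrixP => i j; apply: (@cvg_unique _ _ (sqrt_iter k.+1 i j @[k --> \oo])) => //.
    by have := YE i j; rewrite -cvg_shiftS.
  have entryE (A : 'M[R]_m) : (2^-1 *: (M + A *m A)) i j =
    2^-1 * (M i j + \sum_l A i l * A l j) by rewrite !mxE.
  have -> : (fun k => sqrt_iter k.+1 i j) = (fun k =>
      2^-1 * (M i j + \sum_l sqrt_iter k i l * sqrt_iter k l j)).
    by apply/funext => k; exact: entryE.
  rewrite entryE.
  apply: cvgMl_tmp; apply: cvgD; first exact: cvg_cst.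
  by apply: cvg_big => [|l _]; [exact: add_continuous|exact: cvgM].
exists (1%:M - Y); split.
  apply: psdmx_sub1 => // [i j|i].
    rewrite mxE; apply: limr_ge; first exact: sqrt_iter_cvg.
    by apply: nearW => k; exact: sqrt_iter_ge0.
  have h : \sum_j sqrt_iter k i j @[k --> \oo] --> \sum_j Y i j 
    by apply: cvg_big => [|j _]; [exact: add_continuous|exact: YE].
  rewrite -(cvg_lim _ h)//; apply: limr_le; first by apply/cvg_ex; exists (\sum_j Y i j).
  by apply: nearW => k; exact: sqrt_iter_le1.
have YY : Y *m Y = Y + Y - M.
  rewrite [in RHS]Y_fix -scalerDl.
  have -> : 2^-1 + 2^-1 = 1 :> R by field.
  by rewrite scale1r addrC addKr.
rewrite mulmxBl mul1mx mulmxBr mulmx1 YY.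
by rewrite !opprB; apply/matrixP => i j; rewrite !mxE; ring.
Qed.

(** Existence of a root excludes the default value [0] of [sqrtmx], whose kernel would be
    everything. Then [|S x|^2 = dot (S (S x)) x] by symmetry of [S]. *)
Lemma sqrtmx_ker (x : 'cV[R]_m) :
  sqrtmx (1%:M - M) *m x = 0 <-> (1%:M - M) *m x = 0.
Proof.
rewrite /sqrtmx; have := psd_sqrt_ex => /(xgetPex 0) /=.
set S := xget _ _ => -[[S_sym _] SS]; split => [Sx|Lx].
  by rewrite -SS -mulmxA Sx mulmx0.
apply/enorm_eq0P/eqP; rewrite -sqrf_eq0 sqr_enorm dot_mulmxr.
by rewrite S_sym mulmxA SS Lx /dot trmx0 mul0mx mxE.
Qed.

End SquareRoot.

(** * Block calculus for stacked vectors and the Kronecker product *)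

Section Blocks.
Variables (R : realType) (N n : nat).
Implicit Types (W : 'M[R]_N) (B : 'I_N -> 'M[R]_n) (x y : 'bV[R]_(N, n)).

Lemma blockP x y : (forall i, block x i = block y i) -> x = y.
Proof. by move=> h; apply/mxcolP => i; exact: h. Qed.

Lemma block_mxcol (f : 'I_N -> 'cV[R]_n) i : block (\mxcol_i f i) i = f i.
Proof. exact: mxcolK. Qed.

Lemma mxcol_block x : x = \mxcol_i block x i.
Proof. by rewrite /block submxcolK. Qed.

(** [tagnat.Rank i k] is the position of coordinate [k] of block [i] in the stacked vector. *)
Lemma blockE x i k : block x i k 0 = x (tagnat.Rank i k) 0.
Proof. by rewrite mxE. Qed.

Lemma blockB x y i : block (x - y) i = block x i - block y i.
Proof. exact: submxcolB. Qed.

Lemma dot_block x y : dot x y = \sum_i dot (block x i) (block y i).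
Proof.
rewrite {1}(mxcol_block x) {1}(mxcol_block y) /dot tr_mxcol mul_mxrow_mxcol.
by rewrite summxE.
Qed.

Lemma block_BB B x i : block (BB B *m x) i = B i *m block x i.
Proof. by rewrite {1}(mxcol_block x) /BB mul_mxdiag_mxcol block_mxcol. Qed.

Lemma block_kron_id W x i : block (kron_id n W *m x) i = \sum_j W i j *: block x j.
Proof.
rewrite {1}(mxcol_block x) /kron_id mul_mxblock_mxrow block_mxcol.
by apply: eq_bigr => j _; rewrite -scalemxAl mul1mx.
Qed.

Lemma kron_idE W i j k l :
  kron_id n W (tagnat.Rank i k) (tagnat.Rank j l) = W i j * (k == l)%:R.
Proof.
have /matrixP /(_ k l) := mxblockK (fun i j => W i j *: (1%:M : 'M[R]_n)) i j.
by rewrite !mxE.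
Qed.

Lemma BB_offdiag B i j k l : i != j ->
  BB B (tagnat.Rank i k) (tagnat.Rank j l) = 0.
Proof.
(* The family spelled out here is the unfolding of [\mxdiag], whose diagonal blocks pass through
   [conform_mx]. *)
move=> /negPf ij; have /matrixP /(_ k l) := mxblockK
  (fun i j => if i == j then conform_mx (0 : 'M[R]_(n, n)) (B i) else 0) i j.
by rewrite ij [X in _ = X]mxE => <-; rewrite [RHS]mxE.
Qed.

Lemma tr_kron_id W : W^T = W -> (kron_id n W)^T = kron_id n W.
Proof.
move=> W_sym; rewrite /kron_id tr_mxblock; apply: eq_mxblock => i j.
by rewrite linearZ /= trmx1 -[in LHS]W_sym mxE.
Qed.

Lemma kron_id_ge0 W : (forall i j, 0 <= W i j) -> forall s t, 0 <= kron_id n W s t.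
Proof. by move=> W_ge0 s t; rewrite !mxE mulr_ge0// ler0n. Qed.

(** The row sums are the image of the all-ones vector, which is computed block by block. *)
Lemma kron_id_row_sum W : (forall i, \sum_j W i j = 1) ->
  forall s, \sum_t kron_id n W s t = 1.
Proof.
move=> W1 s; have : kron_id n W *m const_mx 1 = const_mx 1 :> 'bV[R]_(N, n).
  apply: blockP => i; rewrite block_kron_id.
  have bc (j : 'I_N) : block (const_mx 1) j = const_mx 1 :> 'cV[R]_n.
    by apply/colP => k; rewrite blockE !mxE.
  by under eq_bigr do rewrite bc; rewrite bc -scaler_suml W1 scale1r.
move=> /colP /(_ s); rewrite !mxE => h; rewrite -[RHS]h.
by apply: eq_bigr => t _; rewrite [const_mx _ _ _]mxE mulr1.
Qed.

End Blocks.

(** * Kernel and range of the Laplacian of the network *)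

Section Consensus.
Variables (R : realType) (N n : nat) (e : rel 'I_N) (W : 'M[R]_N).
Hypothesis hW : network_assumption e W.
Implicit Types x : 'bV[R]_(N, n).

Let W_sym : W^T = W. Proof. by case: hW. Qed.
Let W_ge0 i j : 0 <= W i j. Proof. by case: hW => _ _ [+ _ _] _ _; exact. Qed.
Let W_row i : \sum_j W i j = 1. Proof. by case: hW => _ _ [_ + _] _ _; exact. Qed.

Lemma quad_laplacian x : dot x (laplacian n W *m x) =
  2^-1 * \sum_s \sum_t kron_id n W s t * (x s 0 - x t 0) ^+ 2.
Proof.
rewrite /laplacian quad_sub1; last exact: tr_kron_id.
rewrite big1 ?add0r// => s _.
by rewrite kron_id_row_sum// subrr mul0r.
Qed.

Lemma psdmx_laplacian : psdmx (laplacian n W).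
Proof.
apply: psdmx_sub1; [exact: tr_kron_id|exact: kron_id_ge0|].
by move=> s; rewrite kron_id_row_sum.
Qed.

(** On the kernel the Dirichlet form is a vanishing sum of nonnegative terms. Weights are positive
    on edges, so blocks agree across each edge, and connectivity carries this along paths. *)
Lemma laplacian_ker x :
  laplacian n W *m x = 0 <-> forall i j, block x i = block x j.
Proof.
split=> [Lx|x_const]; last first.
  apply: blockP => i; rewrite mulmxBl mul1mx blockB block_kron_id.
  rewrite (eq_bigr (fun j => W i j *: block x i)) => [|j _]; last first.
    by rewrite (x_const j i).
  rewrite -scaler_suml W_row scale1r subrr.
  by apply/colP => k; rewrite blockE !mxE.
have terms_ge0 s t : 0 <= kron_id n W s t * (x s 0 - x t 0) ^+ 2.
  by rewrite mulr_ge0 ?sqr_ge0 ?kron_id_ge0.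
have edge i j : e i j -> block x i = block x j.
  move=> eij; apply/colP => k; rewrite !blockE.
  have Wij : 0 < W i j.
    by case: hW => _ _ _ + _; apply; rewrite !inE eij orbT.
  have := quad_laplacian x; rewrite Lx /dot mulmx0 mxE => /esym/eqP.
  rewrite mulf_eq0 invr_eq0 pnatr_eq0/= psumr_eq0 => [|s _]; last first.
    by rewrite sumr_ge0.
  move=> /allP /(_ (tagnat.Rank i k) (mem_index_enum _)) /=.
  rewrite psumr_eq0// => /allP /(_ (tagnat.Rank j k) (mem_index_enum _)) /=.
  by rewrite kron_idE eqxx mulr1 mulf_eq0 gt_eqF//= sqrf_eq0 subr_eq0 => /eqP.
move=> i j; have /connectP[p] : connect e i j by case: hW => -[].
elim: p i => [i _ -> //|l p IH i /= /andP[eil pl] jE].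
by rewrite (edge _ _ eil); exact: IH.
Qed.

Lemma consensusP x : consensus W x <-> forall i j, block x i = block x j.
Proof.
rewrite /consensus /= -laplacian_ker.
apply: sqrtmx_ker; [exact: tr_kron_id|exact: kron_id_ge0|].
by move=> s; rewrite kron_id_row_sum.
Qed.

(* The columns of [cokermx L] lie in the kernel of [L], that is, they are
   consensus vectors; a vector orthogonal to those is in the range of the
   symmetric matrix [L]. *)
Lemma laplacian_range (r : 'bV[R]_(N, n)) : \sum_i block r i = 0 ->
  exists v, laplacian n W *m v = r.
Proof.
move=> r0; have L_sym := psdmx_laplacian.1.
suff /submxP[v rv] : (r^T <= laplacian n W)%MS.
  by exists v^T; rewrite -L_sym -trmx_mul -rv trmxK.
rewrite submxE; apply/eqP/rowP => j; rewrite [RHS]mxE.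
pose y := col j (cokermx (laplacian n W)).
have -> : (r^T *m cokermx (laplacian n W)) 0 j = dot r y.
  by rewrite /dot /y; move: (cokermx _) => C; rewrite colE mulmxA -colE [RHS]mxE.
have /laplacian_ker y_const : laplacian n W *m y = 0.
  by rewrite /y colE mulmxA mulmx_coker mul0mx.
(* For [N = 0] the sum is empty. Otherwise all blocks of [y] equal the one at [i0], and the inner
   product factors through the sum of the blocks of [r]. *)
rewrite dot_block; case: (pickP 'I_N) => [i0 _|N0]; last by rewrite big_pred0.
under eq_bigr => i _ do rewrite (y_const i i0) dotC dotE.
rewrite exchange_big /= big1// => k _; rewrite -mulr_sumr.
by move/colP: r0 => /(_ k); rewrite summxE mxE => ->; rewrite mulr0.
Qed.

End Consensus.

(** * Linear systems with a coercive matrix *)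

Section Coercive.
Variables (R : realType) (m : nat) (A : 'M[R]_m) (mu : R).
Hypotheses (mu_gt0 : 0 < mu) (A_ge : forall u, mu * dot u u <= dot u (A *m u)).

Lemma coercive_unitmx : A \in unitmx.
Proof.
rewrite -row_free_unit; apply: inj_row_free => v vA.
apply: trmx_inj; rewrite trmx0; apply/enorm_eq0P/eqP.
rewrite -sqrf_eq0 sqr_enorm eq_le dot_ge0 andbT -(pmulr_rle0 _ mu_gt0).
by apply: le_trans (A_ge _) _; rewrite /dot trmxK mulmxA vA mul0mx mxE.
Qed.

(** [mu |z|^2 <= dot z c <= |z| |c|], divided by [|z|]. The bound involves only [mu] and [c], hence
    is uniform in the penalty parameter. *)
Lemma coercive_solution_le z c : A *m z = c -> mu * enorm z <= enorm c.
Proof.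
move=> Azc; have [->|z0] := eqVneq (enorm z) 0; first by rewrite mulr0 enorm_ge0.
have zp : 0 < enorm z by rewrite lt_def z0 enorm_ge0.
rewrite -(ler_pM2r zp) -mulrA -expr2 sqr_enorm [leRHS]mulrC.
by apply: le_trans (A_ge z) _; rewrite Azc; exact: dot_le_enorm.
Qed.

(** Coercivity tested on a basis vector; it makes the diagonal part invertible, so that [invmx] in
    the JOR matrix is a true inverse. *)
Lemma coercive_diag_gt0 i : 0 < A i i.
Proof.
have dot_delta u : dot (delta_mx i 0) u = u i 0.
  rewrite dotE (bigD1 i)//= big1 => [|j /negPf ji]; last by rewrite mxE ji mul0r.
  by rewrite mxE !eqxx mul1r addr0.
have := A_ge (delta_mx i 0); rewrite !dot_delta -colE !mxE !eqxx mulr1.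
exact: lt_le_trans mu_gt0.
Qed.

Lemma coercive_diag_part_unitmx : diag_part A \in unitmx.
Proof.
rewrite unitmxE det_diag unitfE; apply/prodf_neq0 => i _.
by rewrite mxE gt_eqF// coercive_diag_gt0.
Qed.

End Coercive.

(** * Strong convexity and the minimizer of the aggregate cost *)

Section Costs.
Variables (R : realType) (N n : nat) (B : 'I_N -> 'M[R]_n) (b : 'I_N -> 'cV[R]_n).

Lemma local_costE i y :
  local_cost B b i y = 2^-1 * dot (y - b i) (B i *m (y - b i)).
Proof. by rewrite /local_cost quad_dot. Qed.

(** Convexity at the midpoint of [b i + u] and [b i], where the cost at [b i] is zero: with
    [Q = dot u (B i *m u)] it reads [Q / 8 <= Q / 4 - mu / 8 * dot u u]. *)
Lemma strongly_convex_coercive mu i : strongly_convex mu (local_cost B b i) ->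
  forall u, mu * dot u u <= dot u (B i *m u).
Proof.
move=> conv u; have half01 : 0 <= (2^-1 : R) <= 1 by lra.
have := conv (b i + u) (b i) _ half01; rewrite !local_costE.
have -> : 2^-1 *: (b i + u) + (1 - 2^-1) *: b i - b i = 2^-1 *: u.
  by apply/colP => k; rewrite !mxE; field.
have -> : b i + u - b i = u by rewrite addrC addKr.
rewrite subrr mulmx0 sqr_enorm -scalemxAr !dot_lin.
have -> : dot (0 : 'cV[R]_n) 0 = 0 by rewrite -sqr_enorm enorm0 expr0n.
by lra.
Qed.

Hypothesis B_sym : forall i, (B i)^T = B i.

(** Exact second-order expansion at a stationary point: symmetry of [B i] merges the two cross
    terms, and their sum is the vanishing gradient paired with [y - z]. *)
Lemma aggregate_cost_expand z y : \sum_i B i *m (z - b i) = 0 ->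
  aggregate_cost B b y =
  aggregate_cost B b z + 2^-1 * \sum_i dot (y - z) (B i *m (y - z)).
Proof.
move=> z_stat; apply/eqP; rewrite -subr_eq0 opprD addrA mulr_sumr /aggregate_cost -!sumrB.
rewrite (eq_bigr (fun i => dot (y - z) (B i *m (z - b i)))) => [|i _]; last first.
  rewrite !local_costE.
  have -> : y - b i = (y - z) + (z - b i) by rewrite addrA subrK.
  move: (y - z) (z - b i) => d w; rewrite mulmxDr !dot_lin.
  by rewrite (dot_mulmxr _ w d) B_sym (dotC (B i *m w)); field.
suff -> : \sum_i dot (y - z) (B i *m (z - b i)) =
  dot (y - z) (\sum_i B i *m (z - b i)).
  by rewrite z_stat -(scale0r z) dotZr mul0r.
by rewrite /dot mulmx_sumr summxE.
Qed.

Variable mu : R.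
Hypotheses (N_gt0 : (0 < N)%N) (mu_gt0 : 0 < mu)
  (B_ge : forall i u, mu * dot u u <= dot u (B i *m u)).

Lemma sum_coercive u : mu * dot u u <= \sum_i dot u (B i *m u).
Proof.
rewrite (bigD1 (Ordinal N_gt0))//= -[leLHS]addr0 lerD ?B_ge//.
apply: sumr_ge0 => i _; apply: le_trans (B_ge _ _).
exact: mulr_ge0 (ltW mu_gt0) (dot_ge0 _).
Qed.

Lemma aggregate_stationary_ex : exists z, \sum_i B i *m (z - b i) = 0.
Proof.
have S_ge u : mu * dot u u <= dot u ((\sum_i B i) *m u).
  by rewrite mulmx_suml /dot mulmx_sumr summxE; exact: sum_coercive.
(* Solution of the normal equations [(\sum_i B i) z = \sum_i B i b i]. *)
exists (invmx (\sum_i B i) *m \sum_i B i *m b i).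
under eq_bigr do rewrite mulmxBr.
rewrite sumrB -mulmx_suml mulmxA mulmxV ?mul1mx ?subrr//.
exact: coercive_unitmx mu_gt0 S_ge.
Qed.

Lemma aggregate_unique_minimizer z : \sum_i B i *m (z - b i) = 0 ->
  is_unique_minimizer setT (aggregate_cost B b) z.
Proof.
move=> z_stat.
have growth y : mu / 2 * dot (y - z) (y - z) <=
    aggregate_cost B b y - aggregate_cost B b z.
  rewrite (aggregate_cost_expand y z_stat) addrAC subrr add0r.
  rewrite mulrAC mulrC ler_pM2l ?invr_gt0//.
  exact: sum_coercive.
split; first split=> // y _.
  rewrite -subr_ge0; apply: le_trans (growth y).
  by rewrite mulr_ge0 ?dot_ge0// divr_ge0// ltW.
move=> y [_ /(_ z Logic.I) yz]; apply/eqP; rewrite -subr_eq0; apply/eqP/enorm_eq0P.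
apply/eqP; rewrite -sqrf_eq0 sqr_enorm eq_le dot_ge0 andbT.
have mu2 : 0 < mu / 2 by rewrite divr_gt0.
by rewrite -(pmulr_rle0 _ mu2) (le_trans (growth y))// subr_le0.
Qed.

End Costs.

(** * Coercivity and error of the penalty solutions *)

Section Penalty.
Variables (R : realType) (N n : nat) (e : rel 'I_N) (W : 'M[R]_N).
Variables (B : 'I_N -> 'M[R]_n) (b : 'I_N -> 'cV[R]_n) (mu : R).
Hypotheses (hW : network_assumption e W) (mu_gt0 : 0 < mu)
  (B_ge : forall i u, mu * dot u u <= dot u (B i *m u)).

Lemma BB_ge (u : 'bV[R]_(N, n)) : mu * dot u u <= dot u (BB B *m u).
Proof.
rewrite !dot_block mulr_sumr; apply: ler_sum => i _.
by rewrite block_BB.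
Qed.

(** The Laplacian contributes a nonnegative term, so the constant [mu] of [BB B] survives for every
    [theta]. *)
Lemma penalty_matrix_ge theta : 0 < theta -> forall u : 'bV[R]_(N, n),
  mu * dot u u <= dot u (penalty_matrix W B theta *m u).
Proof.
move=> theta_gt0 u; rewrite mulmxDl dotDr -[leLHS]addr0 lerD ?BB_ge//.
rewrite -scalemxAl dotZr mulr_ge0 ?(ltW theta_gt0)// -quad_dot.
exact: (psdmx_laplacian n hW).2.
Qed.

(* With [e = z - y], [A e = L v], so [mu |e|^2 <= e^T L v - theta e^T L e], and
   completing the square in the semidefinite form [L] removes [e]. *)
Lemma penalty_error theta (y z v : 'bV[R]_(N, n)) : 0 < theta ->
  laplacian n W *m y = 0 -> laplacian n W *m v = rhs B b - BB B *m y ->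
  penalty_matrix W B theta *m z = rhs B b ->
  mu * dot (z - y) (z - y) <= dot v (laplacian n W *m v) / (4 * theta).
Proof.
move=> theta_gt0 Ly Lv Az; have [L_sym L_ge0] := psdmx_laplacian n hW.
set d := z - y; set Lp := laplacian n W in Ly Lv L_sym L_ge0 *.
have Bd : BB B *m d = Lp *m v - theta *: (Lp *m d).
  rewrite Lv -Az /d !mulmxBr Ly subr0 mulmxDl -scalemxAl.
  by rewrite [RHS]addrAC addrK.
have := L_ge0 (theta *: d - 2^-1 *: v); rewrite quad_dot mulmxBr -!scalemxAr !dot_lin.
rewrite [dot v (Lp *m d)]dot_mulmxr L_sym [dot (Lp *m v) d]dotC.
have := BB_ge d; rewrite Bd !dot_lin.
move: (dot d d) (dot d (Lp *m v)) (dot d (Lp *m d)) (dot v (Lp *m v)) => dd p q r h1 h2.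
by rewrite ler_pdivlMr ?mulr_gt0//; nra.
Qed.

End Penalty.

(** * Error propagation of the JOR iteration *)

Section Jor.
Variables (R : realType) (N n : nat) (W : 'M[R]_N) (B : 'I_N -> 'M[R]_n).
Variables (b : 'I_N -> 'cV[R]_n) (theta q : R).
Hypothesis D_unit : diag_part (penalty_matrix W B theta) \in unitmx.

(** The solution [z] is a fixed point of the step: substituting [A z] for the right-hand side, the
    shift [q D^-1 A z] complements [M z] to [z]. *)
Lemma jor_stepB (z y : 'bV[R]_(N, n)) : penalty_matrix W B theta *m z = rhs B b ->
  jor_step W B b theta q y - z = jor_matrix W B theta q *m (y - z).
Proof.
move=> Az; rewrite mulmxBr /jor_step -addrA; congr (_ + _).
rewrite /jor_shift -Az /jor_matrix.
move: (penalty_matrix W B theta) D_unit => A; move: (diag_part A) => D DU.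
rewrite mulmxBr mulVmx// mulmxDl -!scalemxAl mulmxBl !mul1mx mulmxA.
by apply/colP => s; rewrite !mxE; ring.
Qed.

Lemma jor_iter_error rho k (z y : 'bV[R]_(N, n)) :
  penalty_matrix W B theta *m z = rhs B b ->
  opnorm (jor_matrix W B theta q) <= rho ->
  enorm (iter k (jor_step W B b theta q) y - z) <= rho ^+ k * enorm (y - z).
Proof.
move=> Az M_rho; elim: k => [|k IH]; first by rewrite mul1r.
rewrite iterS jor_stepB// exprS -mulrA; apply: le_trans (enorm_mulmx _ _) _.
by apply: ler_pM; rewrite ?opnorm_ge0 ?enorm_ge0.
Qed.

(* [M(theta) = 0] would make [A(theta)] diagonal, hence [W = 1], and then no
   relaxation parameter is admissible. *)
Lemma jor_matrix_neq0 : (0 < N)%N -> (0 < n)%N -> (forall i, \sum_j W i j = 1) ->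
  0 < theta ->
  0 < q < 2 * theta * (1 - max_weight W) / (lipschitz_const B + 2 * theta) ->
  jor_matrix W B theta q != 0.
Proof.
move=> N_gt0 n_gt0 W_row theta_gt0 /andP[q_gt0 q_lt]; apply/eqP => M0.
have offdiag s t : s != t -> penalty_matrix W B theta s t = 0.
  move=> /negPf st; move: M0; rewrite /jor_matrix.
  (* Multiplied by [D], the equation becomes [q (D - A) + (1 - q) D = 0], whose off-diagonal entries
     are those of [- q A]. *)
  move: (penalty_matrix W B theta) D_unit => A DU /(congr1 (mulmx (diag_part A))).
  rewrite mulmx0 mulmxDr -!scalemxAr mulmxA mulmxV// mul1mx mulmx1.
  move=> /matrixP /(_ s t); rewrite /diag_part !mxE st !mulr0n mulr0 addr0 sub0r.
  by move=> /eqP; rewrite mulf_eq0 gt_eqF//= oppr_eq0 => /eqP.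
pose k0 : 'I_n := Ordinal n_gt0.
have W_offdiag i j : i != j -> W i j = 0.
  move=> ij; have st : tagnat.Rank i k0 != tagnat.Rank j k0 :> 'I_(\sum_(i < N) n).
    by apply: contra_neq ij => /(congr1 (@tagnat.sig1 _ _)); rewrite !tagnat.Rank1K.
  have lapE : laplacian n W (tagnat.Rank i k0) (tagnat.Rank j k0) = - W i j.
    have <- : kron_id n W (tagnat.Rank i k0) (tagnat.Rank j k0) = W i j.
      by rewrite kron_idE eqxx mulr1.
    rewrite /laplacian.
    by move: (kron_id n W) => K; rewrite !mxE (negPf st) sub0r.
  have := offdiag _ _ st; rewrite [LHS]mxE BB_offdiag// add0r [LHS]mxE lapE.
  by move=> /eqP; rewrite mulf_eq0 gt_eqF//= oppr_eq0 => /eqP.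
have W_diag i : W i i = 1.
  by rewrite -(W_row i) (bigD1 i)//= big1 ?addr0// => j ji; rewrite W_offdiag// eq_sym.
have W1 : max_weight W = 1.
  rewrite /max_weight -[RHS]sup1; congr sup; apply/seteqP; split=> [_ [i _ <-]|_ ->].
    exact: W_diag.
  by exists (Ordinal N_gt0).
by move: (lt_trans q_gt0 q_lt); rewrite W1 subrr mulr0 mul0r ltxx.
Qed.

End Jor.

(** * Iteration counts and the recursion for the inner errors *)

Section RealSequences.
Variable R : realType.

(** The exponent is at least [|t| >= t], and multiplying by [ln rho < 0] reverses this to a bound by
    [t * ln rho = ln x - ln y], whatever the sign of [t]. *)
Lemma expr_ceil_ln_le (rho x y : R) : 0 < rho < 1 -> 0 < x -> 0 < y ->
  rho ^+ `|Num.ceil `|(ln x - ln y) / ln rho| |%N <= x / y.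
Proof.
move=> /andP[rho_gt0 rho_lt1] x_gt0 y_gt0; set t := (_ / _).
have ln_rho : ln rho < 0 by rewrite ln_lt0// rho_gt0.
have t_le : t <= (`|Num.ceil `|t| |%N)%:R.
  rewrite natr_absz ger0_norm; last first.
    by rewrite ceil_ge0 (lt_le_trans _ (normr_ge0 t))// ltrN10.
  exact: le_trans (ler_norm t) (ceil_ge _).
rewrite -ler_ln ?posrE ?exprn_gt0 ?divr_gt0// lnXn// ln_div ?posrE//.
have -> : ln x - ln y = t * ln rho by rewrite divfK// lt_eqF.
by rewrite -mulr_natl ler_nM2r.
Qed.

(** Induction with [K >= 1]: then [K * eps s + c <= K * (eps s + c)], and the denominator cancels.
    The other entry of the maximum starts the induction at [s0]. *)
Lemma contraction_le_eps (mu c : R) (d eps : nat -> R) (s0 : nat) :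
  0 <= c -> (forall s, 0 < eps s) ->
  (forall s, (s0 <= s)%N ->
     mu * d s.+1 <= eps s.+1 / (eps s + c) * (mu * d s + c)) ->
  exists K, forall s, (s0 <= s)%N -> mu * d s <= K * eps s.
Proof.
move=> c_ge0 eps_gt0 step; pose K := Num.max 1 (mu * d s0 / eps s0).
have K1 : 1 <= K by rewrite le_max lexx.
exists K => s /subnK <-.
elim: (s - s0)%N => [|k IH]; first by rewrite -ler_pdivrMr// le_max lexx orbT.
rewrite addSn; apply: le_trans (step _ (leq_addl _ _)) _; set s' := (k + s0)%N.
have ec : 0 < eps s' + c by rewrite ltr_wpDr.
rewrite mulrAC ler_pdivrMr// [K * _]mulrC -mulrA ler_pM2l// mulrDr lerD//.
by rewrite ler_peMl.
Qed.

End RealSequences.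

Theorem theorem3p1 (R : realType) (N n : nat) (hN : (0 < N)%N) (hn : (0 < n)%N)
    (e : rel 'I_N) (W : 'M[R]_N) (hW : network_assumption e W)
    (B : 'I_N -> 'M[R]_n) (b : 'I_N -> 'cV[R]_n) (hB : forall i, (B i)^T = B i)
    (mu : R) (hmu : 0 < mu)
    (hconv : forall i, strongly_convex mu (local_cost B b i))
    (theta : nat -> R) (htheta0 : forall s, 0 < theta s)
    (htheta : theta s @[s --> \oo] --> +oo)
    (eps : nat -> R) (heps0 : forall s, 0 < eps s)
    (heps : eps s @[s --> \oo] --> (0 : R))
    (q : nat -> R)
    (hq : forall s, 0 < q s.+1 <
      2 * theta s.+1 * (1 - max_weight W) / (lipschitz_const B + 2 * theta s.+1))
    (rho : nat -> R)
    (hrho : forall s,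
      opnorm (jor_matrix W B (theta s.+1) (q s.+1)) <= rho s.+1 < 1)
    (x : nat -> 'bV[R]_(N, n))
    (hx : efix_q_sequence W B b theta q
            (inner_iterations B b mu theta eps rho) x) :
  ~ bounded_seq x \/
  exists xstar : 'bV[R]_(N, n),
    [/\ converges_to x xstar,
        is_minimizer (consensus W) (separable_cost B b) xstar
      & forall i, is_unique_minimizer setT (aggregate_cost B b) (block xstar i)].
Proof.
right; have [_ _ [_ W_row _] _ _] := hW.
have B_ge i : forall u, mu * dot u u <= dot u (B i *m u).
  exact: strongly_convex_coercive (hconv i).
have A_ge s := penalty_matrix_ge hW B_ge (htheta0 s).
have [y y_stat] := aggregate_stationary_ex b hN hmu B_ge.
pose xstar : 'bV[R]_(N, n) := \mxcol_(i < N) y.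
have xstarE i : block xstar i = y by rewrite block_mxcol.
have xstar_cons : forall i j, block xstar i = block xstar j.
  by move=> i j; rewrite !xstarE.
have y_min := aggregate_unique_minimizer hB hN hmu B_ge y_stat.
exists xstar; split; last first.
- by move=> i; rewrite xstarE.
- split; first exact/(consensusP hW).
  move=> w /(consensusP hW) w_cons.
  pose i0 : 'I_N := Ordinal hN.
  have costE v : (forall i j, block v i = block v j) ->
      separable_cost B b v = aggregate_cost B b (block v i0).
    by move=> v_cons; apply: eq_bigr => i _; rewrite (v_cons i i0).
  by rewrite !costE// xstarE; apply: y_min.1.2.
pose c := enorm (rhs B b).
have /choice[z Az] s : exists z, penalty_matrix W B (theta s) *m z = rhs B b.
  exists (invmx (penalty_matrix W B (theta s)) *m rhs B b).
  by rewrite mulmxA mulmxV ?mul1mx//; exact: coercive_unitmx hmu (A_ge s).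
have z_le s : mu * enorm (z s) <= c.
  by have := coercive_solution_le (A_ge s) (Az s).
(* [v] acts as a Lagrange multiplier: the blocks of [rhs B b - BB B *m xstar] sum to minus the
   gradient of the aggregate cost at [y], which is zero. *)
have [v Lv] : exists v, laplacian n W *m v = rhs B b - BB B *m xstar.
  apply: (laplacian_range hW); rewrite -[RHS]oppr0 -[in RHS]y_stat -sumrN.
  apply: eq_bigr => i _.
  by rewrite blockB !block_BB xstarE block_mxcol mulmxBr opprB.
have z_err s : enorm (z s - xstar) <=
    Num.sqrt (dot v (laplacian n W *m v) / (4 * mu) / theta s).
  rewrite -[leLHS]ger0_norm ?enorm_ge0// -sqrtr_sqr; apply: ler_wsqrtr.
  rewrite sqr_enorm -(ler_pM2l hmu).
  apply: le_trans (penalty_error hW B_ge (htheta0 s) _ Lv (Az s)) _.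
    exact/(laplacian_ker hW).
  rewrite le_eqVlt; apply/orP; left; apply/eqP.
  by field; rewrite ?gt_eqF.
pose d s := enorm (x s - z s).
(* A tail suffices for the limit; on it the factor [mu / (L + 2 theta)] left over by the iteration
   count is at most 1. *)
have [s0 hs0] : exists s0, forall s, (s0 <= s)%N ->
    mu <= lipschitz_const B + 2 * theta s.
  have /cvgryPge /(_ ((mu - lipschitz_const B) / 2)) [s0 _ hs0] := htheta.
  by exists s0 => s /hs0 /=; lra.
have d_step s : (s0 <= s)%N ->
    mu * d s.+1 <= eps s.+1 / (eps s + 2 * c) * (mu * d s + 2 * c).
  move=> s0s; have /andP[M_rho rho_lt1] := hrho s.
  set M := jor_matrix _ _ _ _ in M_rho.
  have D_unit := coercive_diag_part_unitmx hmu (A_ge s.+1).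
  have M_gt0 : 0 < opnorm M.
    rewrite lt_def opnorm_ge0 andbT; apply/eqP => /opnorm_eq0P; apply/eqP.
    exact: jor_matrix_neq0 (hq s).
  have rho_gt0 := lt_le_trans M_gt0 M_rho.
  have c_ge0 : 0 <= c by exact: enorm_ge0.
  have ell_ge := hs0 _ (leqW s0s).
  set ell := lipschitz_const B + 2 * theta s.+1 in ell_ge.
  have ell_gt0 : 0 < ell := lt_le_trans hmu ell_ge.
  have ec_gt0 : 0 < eps s + 2 * c by rewrite ltr_wpDr// mulr_ge0.
  have rho01 : 0 < rho s.+1 < 1 by rewrite rho_gt0.
  have rate : rho s.+1 ^+ inner_iterations B b mu theta eps rho s <=
      mu * eps s.+1 / (ell * (eps s + 2 * c)).
    by apply: expr_ceil_ln_le => //; rewrite mulr_gt0.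
  (* The target moves from [z s] to [z s.+1], and both lie in the ball of radius [c / mu]. *)
  have drift : mu * enorm (x s - z s.+1) <= mu * d s + 2 * c.
    have -> : x s - z s.+1 = (x s - z s) + (z s - z s.+1) by rewrite addrA subrK.
    apply: le_trans (ler_wpM2l (ltW hmu) (enormD _ _)) _.
    rewrite mulrDr lerD2l; apply: le_trans (ler_wpM2l (ltW hmu) (enormD _ _)) _.
    rewrite enormN mulrDr (mulr_natl c) mulr2n; exact: lerD (z_le s) (z_le s.+1).
  have := jor_iter_error D_unit (inner_iterations B b mu theta eps rho s) (x s)
    (Az s.+1) M_rho.
  rewrite -hx => /(ler_wpM2l (ltW hmu)) /le_trans; apply.
  rewrite mulrCA.
  (* Exposes a factor [ell], so that the comparison with [rate] reduces to [mu <= ell]. *)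
  have -> : eps s.+1 / (eps s + 2 * c) = ell * (eps s.+1 / (ell * (eps s + 2 * c))).
    by field; rewrite !gt_eqF.
  apply: (ler_pM _ _ _ drift); first exact: exprn_ge0 (ltW rho_gt0).
    exact: mulr_ge0 (ltW hmu) (enorm_ge0 _).
  apply: le_trans rate _; rewrite -mulrA ler_wpM2r//.
  by rewrite ltW// divr_gt0// mulr_gt0.
have [|K hK] := contraction_le_eps _ heps0 d_step.
  by rewrite mulr_ge0// enorm_ge0.
pose bound s := K / mu * eps s +
  Num.sqrt (dot v (laplacian n W *m v) / (4 * mu) / theta s).
have bound0 : bound s @[s --> \oo] --> (0 : R).
  have -> : (0 : R) = K / mu * 0 +
      Num.sqrt (dot v (laplacian n W *m v) / (4 * mu) * 0).
    by rewrite !mulr0 sqrtr0 addr0.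
  apply: cvgD; first exact: cvgMl_tmp.
  apply: continuous_cvg; first exact: sqrt_continuous.
  apply: cvgMl_tmp.
  by apply/gtr0_cvgV0 => //; exact: nearW.
apply: (squeeze_cvgr _ (cvg_cst 0) bound0); near=> s.
rewrite enorm_ge0 /=.
have -> : x s - xstar = (x s - z s) + (z s - xstar) by rewrite addrA subrK.
apply: le_trans (enormD _ _) _; apply: lerD (z_err s).
rewrite mulrAC ler_pdivlMr// mulrC; apply: hK.
by near: s; exact: nbhs_infty_ge.
Unshelve. all: by end_near. Qed.
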